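(* Let $n\ge 3$ be an even integer. Then for every Abelian group $\Gamma$ of order $n^2$, the Cartesian product $C_n\square C_n$ has a $\Gamma$-distance magic labeling.
   Context: $C_n$ denotes the cycle on $n\ge 3$ vertices. The Cartesian product $G\square H$ of graphs $G,H$ has vertex set $V(G)\times V(H)$; $(g,h)$ and $(g',h')$ are adjacent iff either $g=g'$ and $h$ is adjacent to $h'$ in $H$, or $h=h'$ and $g$ is adjacent to $g'$ in $G$. For a finite simple graph $G=(V,E)$ and an Abelian group $\Gamma$ (written additively) with $|\Gamma|=|V|$, a $\Gamma$-distance magic labeling of $G$ is a bijection $\ell\colon V\to\Gamma$ for which there exists $\mu\in\Gamma$ such that $\sum_{u\in N(v)}\ell(u)=\mu$ for every $v\in V$, where $N(v)$ is the open neighborhood of $v$. *)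

(* Defs.v *)
From HB Require Import structures.
From mathcomp Require Import all_boot all_order all_algebra.

Set Implicit Arguments.
Unset Strict Implicit.
Unset Printing Implicit Defensive.

Import GRing.Theory.

(* A finite simple graph is given by its vertex set V : finType and its
   adjacency relation, a symmetric irreflexive e : rel V. *)

(* [ordS i] is the successor of i modulo n. For n >= 3 this is the cycle C_n;
   for n = 1 it is a loop. *)
Definition cycle_graph (n : nat) : rel 'I_n :=
  [rel i j | (j == ordS i) || (i == ordS j)].
Arguments cycle_graph n : clear implicits.

Definition cartesian_product (V W : finType) (e : rel V) (f : rel W) :
    rel (V * W) :=
  [rel x y | (x.1 == y.1) && f x.2 y.2 || (x.2 == y.2) && e x.1 y.1].

Definition open_neighborhood (V : finType) (e : rel V) (v : V) : {set V} :=
  [set u | e v u].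

(* The requirement #|Gamma| = #|V| is implied by bijectivity. *)
Definition distance_magic_labeling (V : finType) (e : rel V)
    (Gamma : finZmodType) (l : V -> Gamma) : Prop :=
  bijective l /\
  exists mu : Gamma,
    forall v : V, (\sum_(u in open_neighborhood e v) l u)%R = mu.

Lemma cycle_graph_sym n : symmetric (cycle_graph n).
Proof. by move=> i j; rewrite /cycle_graph /= orbC. Qed.

Lemma cycle_graph_irr n : 3 <= n -> irreflexive (cycle_graph n).
Proof.
move=> n3 i; rewrite /cycle_graph /= orbb; apply/negbTE/eqP => /(congr1 val) /= E.
have := ltn_ord i; rewrite leq_eqVlt => /orP[/eqP iE|lti].
  by move: E; rewrite iE modnn => i0; move: n3; rewrite -iE i0.
by move: E; rewrite modn_small // => /eqP; rewrite ltn_eqF.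
Qed.

Lemma cartesian_product_sym (V W : finType) (e : rel V) (f : rel W) :
  symmetric e -> symmetric f -> symmetric (cartesian_product e f).
Proof.
by move=> es fs x y; rewrite /cartesian_product /= es fs (eq_sym x.1) (eq_sym x.2).
Qed.

Lemma cartesian_product_irr (V W : finType) (e : rel V) (f : rel W) :
  irreflexive e -> irreflexive f -> irreflexive (cartesian_product e f).
Proof. by move=> ei fi x; rewrite /cartesian_product /= ei fi !andbF. Qed.

(* Main.v *)
Require Import Defs.
From HB Require Import structures.
From mathcomp Require Import all_boot all_order all_algebra.
From mathcomp Require Import all_fingroup all_solvable zify.

Import GRing.Theory.

(** Rotate the torus: put s = i + j and d = i - j, so that the neighbors of
    (s, d) are the four points (s +- 1, d +- 1).  Let sg t = + when t mod 4 is
    0 or 1 and sg t = - otherwise; then sg (t + 1) = - sg (t - 1), so any label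
      sg(d) a(s) + sg(s) b(d)
    has zero neighbor sums, whatever a and b are, and a further term
    e (F(s) + F(d)) with 2e = 0 also contributes nothing.  The pairs (s, d) mod n
    determine (i, j) only up to translation by (n/2, n/2); taking F with
    F(t + n) = F(t) + 1 mod 2, the term e (F(s) + F(d)) tells the two apart.

    If n = 4k, take subgroups <e> < S < G0 < Gamma of orders 2, 2k, 8k^2, 16k^2.
    Let b enumerate G0 / S along d mod n, let a enumerate S / <e> along
    (s mod n) / 4, take F(t) = floor (t / n), and add an r outside G0 when
    sg s = -, which shifts every neighbor sum by 2r.  A label is decoded down
    the chain: modulo G0 it gives sg s, modulo S then d, modulo <e> then s.

    If n = 2m with m odd, then sg (t + n) = - sg t, so sg itself serves as F and
    the twisted terms become sg(s) sg(d) (A(s) + B(d)), with A + B running over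
    the subgroup O of order m^2; g [s odd] is added, where e and g generate a
    subgroup of order 4, which meets O trivially. *)

(** * Subgroups and coset representatives in finite Abelian groups *)

Lemma abelian_intermediate_subgroup (gT : finGroupType) (E G : {group gT})
    (d : nat) :
  abelian G -> E \subset G -> #|E| %| d -> d %| #|G| ->
  exists H : {group gT}, [/\ E \subset H, H \subset G & #|H| = d].
Proof.
move=> abG; have [k] := ubnP (#|G| - #|E|).
elim: k E => // k IHk E leEk sEG dvEd dvdG.
have [dE | neqdE] := eqVneq #|E| d; first by exists E.
have d_gt0 : 0 < d by apply: dvdn_gt0 dvdG.
have dE_gt1 : 1 < d %/ #|E|.
  have := divnK dvEd; case: (_ %/ _) => [|[|q]] // Ed; first by lia.
  by rewrite -Ed mul1n eqxx in neqdE.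
have nEG : (E <| G)%g by rewrite /normal sEG (sub_abelian_norm abG).
have cardGE : #|(G / E)%g| = #|G| %/ #|E| by rewrite card_quotient ?normal_norm // divgS.
(* A subgroup of prime order [p] in the quotient by [E] pulls back to [K], larger than [E] by the
   factor [p] and still of order dividing [d]. The induction is on the gap between the orders of [G]
   and [E]. *)
set p := pdiv (d %/ #|E|); have p_pr : prime p by apply: pdiv_prime.
have dvpGE : p %| #|(G / E)%g|.
  rewrite cardGE (dvdn_trans (pdiv_dvd _)) //.
  by rewrite dvdn_divRL ?cardSg // divnK.
have [x xGE ox] := Cauchy p_pr dvpGE.
have sxGE : <[x]>%g \subset (G / E)%g by rewrite cycle_subG.
case/(inv_quotientS nEG): (sxGE) => K defK sEK sKG.
have cardK : #|K| = (#|E| * p)%N.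
  have nEK : (E <| K)%g by apply: normalS nEG.
  rewrite -(Lagrange sEK); congr (_ * _)%N.
  by rewrite -card_quotient ?normal_norm // -defK -ox.
have leKG := subset_leq_card sKG.
have dvKd : #|K| %| d by rewrite cardK -(divnK dvEd) mulnC dvdn_pmul2r // pdiv_dvd.
have ltEK : #|E| < #|K| by rewrite cardK ltn_Pmulr ?prime_gt1.
have ltKk : #|G| - #|K| < k by move: leEk ltEK leKG; clear; lia.
have [H [sKH sHG oH]] := IHk K ltKk sKG dvKd dvdG.
by exists H; split=> //; apply: subset_trans sKH.
Qed.

Lemma coset_representatives (gT : finGroupType) (H G : {group gT}) (r : nat) :
  (H <| G)%g -> (#|G| = #|H| * r)%N ->
  exists t : nat -> gT, (forall i, t i \in G) /\
    (forall i j, i < r -> j < r -> (t i * (t j)^-1)%g \in H -> i = j).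
Proof.
move=> nHG cardG.
have oGH : #|(G / H)%g| = r.
  by rewrite card_quotient ?normal_norm // -divgS ?normal_sub // cardG mulKn.
(* The default, the identity coset, keeps [t i] in [G] for every index [i], beyond [r] as well. *)
pose u i := nth 1%g (enum (G / H)%g) i.
have u_in i : u i \in (G / H)%g.
  have [lt_i_r | le_r_i] := ltnP i r.
    by rewrite -mem_enum mem_nth // -cardE oGH.
  by rewrite /u nth_default ?group1 // -cardE oGH.
exists (fun i => repr (u i)); split=> [i | i j lti ltj].
  have : coset H (repr (u i)) \in (G / H)%g by rewrite coset_reprK.
  case/morphimP=> x Nx Gx /esym.
  case/(rcoset_kercosetP Nx (repr_coset_norm _)) /rcosetP=> y Hy defx.
  have -> : repr (u i) = (y^-1 * x)%g by rewrite defx mulKg.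
  by rewrite groupM ?groupV // (subsetP (normal_sub nHG)).
move=> Hij; have : u i = u j.
  rewrite -(coset_reprK (u i)) -(coset_reprK (u j)).
  by apply/rcoset_kercosetP; rewrite ?repr_coset_norm // mem_rcoset.
by move/eqP; rewrite nth_uniq ?enum_uniq -?cardE ?oGH // => /eqP.
Qed.

(** * Twisted labels and their neighbor sums *)

Local Open Scope ring_scope.

Definition sg4 (t : int) : bool := (t %% 4 < 2)%Z.
Definition signed {V : zmodType} (b : bool) (v : V) : V := if b then v else - v.

Lemma sg4_step t : sg4 (t + 1) = ~~ sg4 (t - 1).
Proof. rewrite /sg4; lia. Qed.

Lemma signedC (V : zmodType) (b : bool) (v : V) : signed b v + signed (~~ b) v = 0.
Proof. by case: b; rewrite /signed /= ?subrr // addNr. Qed.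

(** One shape serves both cases: [c] holds the offset by r or by g, and [F] is the parity of floor(s
    / n) or [sg4] itself. *)
Definition twisted_label {V : zmodType} (a b c : int -> V) (F : int -> bool)
    (e : V) (s d : int) : V :=
  signed (sg4 d) (a s) + signed (sg4 s) (b d) + c s + e *+ (F s (+) F d).

Definition diagonal_sum {V : zmodType} (f : int -> int -> V) (s d : int) : V :=
  f (s + 1) (d + 1) + f (s + 1) (d - 1) + f (s - 1) (d + 1) + f (s - 1) (d - 1).

Lemma diagonal_sumD (V : zmodType) (f g : int -> int -> V) (s d : int) :
  diagonal_sum (fun s d => f s d + g s d) s d
    = diagonal_sum f s d + diagonal_sum g s d.
Proof.
rewrite /diagonal_sum [RHS]addrACA; congr (_ + _).
by rewrite [RHS]addrACA; congr (_ + _); rewrite addrACA.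
Qed.

Lemma twisted_label_sum (V : zmodType) (a b c : int -> V) (F : int -> bool)
    (e h : V) (s d : int) :
  e *+ 2 = 0 -> (forall t, (c (t + 1) + c (t - 1)) *+ 2 = h) ->
  diagonal_sum (twisted_label a b c F e) s d = h.
Proof.
move=> e2 ch; transitivity
  (diagonal_sum (fun s d => signed (sg4 d) (a s)) s d
   + diagonal_sum (fun s d => signed (sg4 s) (b d)) s d
   + diagonal_sum (fun s d => c s) s d
   + diagonal_sum (fun s d => e *+ (F s (+) F d)) s d).
  by rewrite -!diagonal_sumD.
have sC (x : bool) (v : V) : signed (~~ x) v + signed x v = 0.
  by rewrite addrC signedC.
(* Between [d - 1] and [d + 1] the sign flips while the argument of [a] stays, so the terms cancel
   in pairs. *)
have -> : diagonal_sum (fun s d => signed (sg4 d) (a s)) s d = 0.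
  by rewrite /diagonal_sum !sg4_step -addrA !sC addr0.
have -> : diagonal_sum (fun s d => signed (sg4 s) (b d)) s d = 0.
  by rewrite /diagonal_sum !sg4_step -addrA addrACA !sC addr0.
have -> : diagonal_sum (fun s d => c s) s d = h.
  by rewrite /diagonal_sum -(ch s) mulrnDl !mulr2n !addrA.
rewrite /diagonal_sum -!mulrnDr !add0r.
(* Each of the four values of [F] enters exactly two of the four exclusive ors, so their total is
   even. *)
set k := (X in e *+ X); have even_k : ~~ odd k.
  by rewrite /k; case: (F _); case: (F _); case: (F _); case: (F _).
by rewrite -(even_halfK even_k) -mul2n mulrnA e2 mul0rn addr0.
Qed.

(** The range of the coordinates leaves only shifts by 0, n or -n for the sum and for the
    difference. If both shifts are nonzero, [i] or [j] moves by n and leaves its range; if exactly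
    one is, the exclusive or of the [F] values flips. *)
Lemma ordinal_twisted_coordinates (n : nat) (F : int -> bool) (i j i' j' : 'I_n) :
  (forall t, F (t + n%:Z) = ~~ F t) ->
  (i%:Z + j%:Z = i'%:Z + j'%:Z %[mod n])%Z ->
  (i%:Z - j%:Z = i'%:Z - j'%:Z %[mod n])%Z ->
  F (i%:Z + j%:Z) (+) F (i%:Z - j%:Z) = F (i'%:Z + j'%:Z) (+) F (i'%:Z - j'%:Z) ->
  (i, j) = (i', j').
Proof.
move=> Fn.
have step (s s' : int) : (s = s' %[mod n])%Z -> `|s - s'| < 2 * n%:Z ->
    [\/ s = s', s = s' + n%:Z | s' = s + n%:Z].
  move=> /eqP; rewrite eqz_mod_dvd => /dvdzP[q dq] lt.
  have : q = 0 \/ q = 1 \/ q = -1 by nia.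
  by case=> [q0|[q0|q0]]; rewrite q0 in dq; 
    [constructor 1 | constructor 2 | constructor 3]; lia.
have lti := ltn_ord i; have ltj := ltn_ord j.
have lti' := ltn_ord i'; have ltj' := ltn_ord j'.
have eqij : i%:Z = i'%:Z -> j%:Z = j'%:Z -> (i, j) = (i', j').
  by move=> [ei] [ej]; congr pair; apply: val_inj.
move=> /step => [/(_ ltac:(lia)) hs] /step => [/(_ ltac:(lia)) hd].
case: hs hd => [es|es|es] [ed|ed|ed]; rewrite ?es ?ed ?Fn => hF;
  first [by apply: eqij; lia | by exfalso; lia
        | by move: hF; case: (F _); case: (F _)].
Qed.

(** * Neighborhoods in the torus *)

Lemma cycle_neighborE (n : nat) (i j : 'I_n) :
  cycle_graph n i j = (j == ordS i) || (j == ord_pred i).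
Proof.
rewrite /cycle_graph /=; congr (_ || _).
by rewrite -[RHS](inj_eq (@ordS_inj n)) ord_predK eq_sym.
Qed.

Lemma ordS_neq (n : nat) (i : 'I_n) : (2 <= n)%N -> ordS i != i.
Proof.
move=> n2; rewrite -val_eqE /=; have := ltn_ord i.
have [lt _|le lt] := ltnP i.+1 n; first by rewrite modn_small // gtn_eqF.
have -> : i.+1 = n by lia.
rewrite modnn; lia.
Qed.

Lemma ordS_neq_pred (n : nat) (i : 'I_n) : (3 <= n)%N -> ordS i != ord_pred i.
Proof.
move=> n3; rewrite -(inj_eq (@ordS_inj n)) ord_predK -val_eqE /=.
have := ltn_ord i.
have [lt _|le lt] := ltnP i.+1 n; last first.
  have -> : i.+1 = n by lia.
  rewrite modnn modn_small; lia.
rewrite (modn_small lt).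
have [lt2|le2] := ltnP i.+2 n; first by rewrite modn_small //; lia.
have -> : i.+2 = n by lia.
rewrite modnn; lia.
Qed.

Lemma intz_ordS {n : nat} (i : 'I_n) :
  (ordS i)%:Z = i%:Z + 1 \/ (ordS i)%:Z = i%:Z + 1 - n%:Z.
Proof.
rewrite /=; have := ltn_ord i.
have [lt _|le lt] := ltnP i.+1 n; first by left; rewrite modn_small //; lia.
right; have -> : i.+1 = n by lia.
rewrite modnn; lia.
Qed.

Lemma torus_neighborhood_sum (n : nat) (V : nmodType) (l : 'I_n * 'I_n -> V)
    (i j : 'I_n) :
  (3 <= n)%N ->
  \sum_(u in open_neighborhood
                (cartesian_product (cycle_graph n) (cycle_graph n)) (i, j)) l u
    = l (ordS i, j) + l (i, ordS j) + l (i, ord_pred j) + l (ord_pred i, j).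
Proof.
move=> n3; have n2 : (2 <= n)%N by apply: ltnW.
have neqP k : ord_pred k != k :> 'I_n.
  by rewrite -(inj_eq (@ordS_inj n)) ord_predK eq_sym ordS_neq.
have -> : open_neighborhood
    (cartesian_product (cycle_graph n) (cycle_graph n)) (i, j) =
    [set (ordS i, j); (i, ordS j); (i, ord_pred j); (ord_pred i, j)].
  apply/setP=> [[x y]]; rewrite inE.
  transitivity ((i == x) && cycle_graph n j y || (j == y) && cycle_graph n i x).
    by [].
  rewrite !cycle_neighborE !inE !xpair_eqE.
  rewrite (eq_sym i x) (eq_sym j y).
  by case: (x == i); case: (y == j); case: (x == ordS i); case: (y == ordS j);
     case: (x == ord_pred i); case: (y == ord_pred j).
(* For [n >= 3] the four neighbors are distinct, so the sum over the set splits into four terms. *)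
rewrite -!setUA !big_setU1 ?big_set1 /=; first by rewrite !addrA.
all: rewrite !inE !xpair_eqE ?negb_or ?negb_and.
all: by rewrite ?[i == _]eq_sym ?[j == _]eq_sym ?neqP ?ordS_neq ?ordS_neq_pred ?orbT.
Qed.

(** Adding n to i shifts (s, d) by (n, n), and adding n to j shifts it by (n, -n). The two
    periodicity hypotheses thus let wrap-around neighbors be computed with integer coordinates. *)
Lemma diagonal_labeling (n : nat) (Gamma : finZmodType)
    (f : int -> int -> Gamma) (h : Gamma) :
  (3 <= n)%N -> #|Gamma| = (n ^ 2)%N ->
  (forall s d, f (s + n%:Z) (d + n%:Z) = f s d) ->
  (forall s d, f (s + n%:Z) (d - n%:Z) = f s d) ->
  (forall s d, diagonal_sum f s d = h) ->
  let l (v : 'I_n * 'I_n) := f (v.1%:Z + v.2%:Z) (v.1%:Z - v.2%:Z) in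
  injective l ->
  distance_magic_labeling (cartesian_product (cycle_graph n) (cycle_graph n)) l.
Proof.
move=> n3 cardG fnn fnN fsum l l_inj; split.
  by apply: inj_card_bij => //; rewrite cardG card_prod card_ord; lia.
exists h => -[i j]; rewrite torus_neighborhood_sum //.
pose g (x y : int) := f (x + y) (x - y).
have gl x y : l (x, y) = g x%:Z y%:Z by [].
have gn1 x y : g (x + n%:Z) y = g x y.
  by rewrite /g -(fnn (x + y)); congr (f _ _); lia.
have gn2 x y : g x (y + n%:Z) = g x y.
  by rewrite /g -(fnN (x + y)); congr (f _ _); lia.
have gS1 (k : 'I_n) y : g (ordS k)%:Z y = g (k%:Z + 1) y.
  by case: (intz_ordS k) => -> //; rewrite -gn1 subrK.
have gS2 x (k : 'I_n) : g x (ordS k)%:Z = g x (k%:Z + 1).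
  by case: (intz_ordS k) => -> //; rewrite -gn2 subrK.
have gP1 (k : 'I_n) y : g (ord_pred k)%:Z y = g (k%:Z - 1) y.
  rewrite -{2}(ord_predK k); case: (intz_ordS (ord_pred k)) => ->.
    by rewrite addrK.
  by rewrite -[RHS]gn1; congr (g _ _); lia.
have gP2 x (k : 'I_n) : g x (ord_pred k)%:Z = g x (k%:Z - 1).
  rewrite -{2}(ord_predK k); case: (intz_ordS (ord_pred k)) => ->.
    by rewrite addrK.
  by rewrite -[RHS]gn2; congr (g _ _); lia.
rewrite !gl gS1 gS2 gP1 gP2 -(fsum (i%:Z + j%:Z) (i%:Z - j%:Z)) /diagonal_sum /g.
by congr (f _ _ + f _ _ + f _ _ + f _ _); lia.
Qed.

(** * Subgroups in additive notation, and residue arithmetic *)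

Lemma subgroup0 (V : finZmodType) (H : {group V}) : 0 \in H.
Proof. exact: group1. Qed.

Lemma subgroupDl (V : finZmodType) (H : {group V}) (x y : V) :
  x \in H -> (x + y \in H) = (y \in H).
Proof. exact: groupMl. Qed.

Lemma subgroupDr (V : finZmodType) (H : {group V}) (x y : V) :
  x \in H -> (y + x \in H) = (y \in H).
Proof. exact: groupMr. Qed.

Lemma subgroupN (V : finZmodType) (H : {group V}) (x : V) : (- x \in H) = (x \in H).
Proof. exact: groupV. Qed.

Lemma subgroup_signed (V : finZmodType) (H : {group V}) (b : bool) (x : V) :
  (signed b x \in H) = (x \in H).
Proof. by case: b; rewrite /signed ?subgroupN. Qed.

Lemma subgroupB (V : finZmodType) (H : {group V}) (x y : V) :
  x \in H -> y \in H -> x - y \in H.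
Proof. by move=> Hx Hy; rewrite subgroupDl // subgroupN. Qed.

Lemma subgroup_mulrb (V : finZmodType) (H : {group V}) (x : V) (b : bool) :
  x \in H -> x *+ b \in H.
Proof. by case: b => //= _; apply: subgroup0. Qed.

Lemma signedB (V : zmodType) (b : bool) (x y : V) :
  signed b x - signed b y = signed b (x - y).
Proof. by case: b; rewrite /signed // opprD. Qed.

(** Turns equality of two labels into a vanishing sum of termwise differences, the form in which
    decoding peels off one subgroup after another. *)
Lemma addr4_eq0 (V : zmodType) (x1 x2 x3 x4 y1 y2 y3 y4 : V) :
  x1 + x2 + x3 + x4 = y1 + y2 + y3 + y4 ->
  (x1 - y1) + (x2 - y2) + (x3 - y3) + (x4 - y4) = 0.
Proof.
move=> eqxy; rewrite (addrACA x1) -opprD (addrACA (x1 + x2)) -opprD.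
by rewrite (addrACA (x1 + x2 + x3)) -opprD eqxy subrr.
Qed.

Lemma mulrb_inj (V : zmodType) (e : V) (b b' : bool) :
  e != 0 -> e *+ b - e *+ b' = 0 -> b = b'.
Proof.
by move=> e0; case: b; case: b' => //= /eqP; rewrite ?subr0 ?sub0r ?oppr_eq0 (negbTE e0).
Qed.

Lemma involution_exists (V : finZmodType) :
  (2 %| #|V|)%N -> exists2 e : V, e != 0 & #|<[e]>%g| = 2%N.
Proof.
rewrite -cardsT => /(Cauchy (G := [set: V]%G) (isT : prime 2))[e _ oe].
by exists e => //; apply/eqP=> e0; move: oe; rewrite e0 order1.
Qed.

Lemma modz_modz_dvd (d n : nat) (x : int) :
  (d %| n)%N -> ((x %% n)%Z %% d)%Z = (x %% d)%Z.
Proof.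
by move=> /dvdnP[q ->]; rewrite [in RHS](divz_eq x (q * d)%N) PoszM mulrA modzMDl.
Qed.

Lemma absz_modz_lt (n : nat) (x : int) : (0 < n)%N -> (`|(x %% n)%Z| < n)%N.
Proof.
move=> n0; have := ltz_pmod x (d := n); have := modz_ge0 x (d := n); lia.
Qed.

(** Cut the residues mod n into blocks of length q: a residue is fixed by its block and its position
    in the block. *)
Lemma eqz_mod_divn (n q : nat) (x y : int) :
  (0 < n)%N -> (q %| n)%N -> (x = y %[mod q])%Z ->
  (`|(x %% n)%Z| %/ q = `|(y %% n)%Z| %/ q)%N -> (x = y %[mod n])%Z.
Proof.
move=> n0 qn eqq eqdiv; have nz : n%:Z != 0 by lia.
have abs_mod z : `|(z %% n)%Z|%N = (z %% n)%Z :> int by apply/gez0_abs/modz_ge0.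
have absq z : (`|(z %% n)%Z| %% q)%N = (z %% q)%Z :> int.
  by rewrite -modz_nat abs_mod modz_modz_dvd.
rewrite -(abs_mod x) -(abs_mod y); congr Posz.
rewrite [LHS](divn_eq _ q) [RHS](divn_eq _ q) eqdiv.
by congr (_ + _)%N; apply/eqP; rewrite -eqz_nat !absq eqq.
Qed.

Lemma eqz_add_mod2 (x y x' y' : int) :
  (x - y = x' - y' %[mod 2])%Z -> (x + y = x' + y' %[mod 2])%Z.
Proof.
have addE (u v : int) : u + v = v * 2 + (u - v) by lia.
by move=> eqB; rewrite (addE x) (addE x') !modzMDl.
Qed.

(** The sign gives the high binary digit of the residue mod 4, and the parity gives the low one. *)
Lemma sg4_mod4 (x y : int) :
  sg4 x = sg4 y -> (x = y %[mod 2])%Z -> (x = y %[mod 4])%Z.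
Proof.
rewrite /sg4 -(modz_modz_dvd 2 4 x) // -(modz_modz_dvd 2 4 y) //.
have := modz_ge0 x (d := 4) isT; have := ltz_pmod x (d := 4) isT.
have := modz_ge0 y (d := 4) isT; have := ltz_pmod y (d := 4) isT.
by case: (x %% 4)%Z => [[|[|[|[|u]]]]|u] //; case: (y %% 4)%Z => [[|[|[|[|v]]]]|v].
Qed.

(** * The case where 4 divides n *)

Lemma torus_labeling_doubly_even (k : nat) (Gamma : finZmodType) :
  (0 < k)%N -> #|Gamma| = ((4 * k) ^ 2)%N ->
  exists l : 'I_(4 * k) * 'I_(4 * k) -> Gamma,
    distance_magic_labeling
      (cartesian_product (cycle_graph (4 * k)) (cycle_graph (4 * k))) l.
Proof.
move=> k0 cardG; set n := (4 * k)%N in cardG *.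
have abG (A : {set Gamma}) : abelian A by apply: FinRing.zmod_abelian.
have normG (A B : {group Gamma}) : A \subset B -> (A <| B)%g.
  by move=> sAB; rewrite /normal sAB (sub_abelian_norm (abG B)).
have [|e e0 oE] := involution_exists Gamma.
  by rewrite cardG; apply/dvdnP; exists (8 * k ^ 2)%N; lia.
have [||S [sES _ oS]] := abelian_intermediate_subgroup _ <[e]>%G [set: Gamma]%G
  (2 * k)%N (abG _) (subsetT _).
- by rewrite oE dvdn_mulr.
- by rewrite cardsT cardG; apply/dvdnP; exists (8 * k)%N; lia.
have [||G0 [sSG _ oG0]] := abelian_intermediate_subgroup _ S [set: Gamma]%G
  (8 * k ^ 2)%N (abG _) (subsetT _).
- by rewrite oS; apply/dvdnP; exists (4 * k)%N; lia.
- by rewrite cardsT cardG; apply/dvdnP; exists 2%N; lia.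
have [r _ rG0] : exists2 r, r \in [set: Gamma] & r \notin G0.
  by apply/subsetPn/negP => /subset_leq_card; rewrite cardsT cardG oG0; lia.
have [|t [tS t_inj]] := coset_representatives _ _ _ k (normG _ _ sES).
  by rewrite oS oE.
have [|w [wG w_inj]] := coset_representatives _ _ _ n (normG _ _ sSG).
  by rewrite oS oG0; lia.
have eE : e \in <[e]>%G by apply: cycle_id.
have e2 : e *+ 2 = 0 by rewrite -oE; apply: expg_order.
have n0 : (0 < n)%N by lia.
have n4 : (4 %| n)%N by apply: dvdn_mulr.
(* There are only [k] cosets of <e> in [S], so [a] is constant on blocks of four residues; the
   position in a block comes from the sign and the parity of s. *)
pose a (s : int) : Gamma := t (`|(s %% n)%Z| %/ 4)%N.
pose b (d : int) : Gamma := w `|(d %% n)%Z|%N.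
pose c (s : int) : Gamma := if sg4 s then 0 else r.
pose F (s : int) : bool := ((s %/ n)%Z %% 2 == 1)%Z.
have sgn s : sg4 (s + n%:Z) = sg4 s by rewrite /sg4 /n; lia.
have sgN s : sg4 (s - n%:Z) = sg4 s by rewrite /sg4 /n; lia.
have Fn s : F (s + n%:Z) = ~~ F s.
  rewrite /F divzDr ?dvdzz // divzz; lia.
have FN s : F (s - n%:Z) = ~~ F s by rewrite -[s in RHS](subrK n%:Z) Fn negbK.
have modN s : ((s - n%:Z) %% n)%Z = (s %% n)%Z by rewrite -(modzDr (s - _)) subrK.
have aS s : a s \in S by apply: tS.
have bG s : b s \in G0 by apply: wG.
have eS (x : bool) : e *+ x \in S by apply: subgroup_mulrb; apply: (subsetP sES).
exists (fun v : 'I_n * 'I_n =>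
  twisted_label a b c F e (v.1%:Z + v.2%:Z) (v.1%:Z - v.2%:Z)).
apply: (diagonal_labeling _ _ _ (r *+ 2)) => //; first by lia.
- by move=> s d; rewrite /twisted_label /a /b /c !sgn !Fn !modzDr addNb addbN negbK.
- move=> s d; rewrite /twisted_label /a /b /c !sgn !sgN Fn FN modzDr modN.
  by rewrite addNb addbN negbK.
- move=> s d; apply: twisted_label_sum => // u; congr (_ *+ 2).
  (* Exactly one of u + 1 and u - 1 has sign -, so the two offsets always add up to [r]. *)
  by rewrite /c sg4_step; case: (sg4 _); rewrite /= ?addr0 ?add0r.
move=> [i j] [i' j'] /=.
set s := i%:Z + j%:Z; set d := i%:Z - j%:Z.
set s' := i'%:Z + j'%:Z; set d' := i'%:Z - j'%:Z.
move=> /addr4_eq0 key.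
have aB x y : signed x (a s) - signed y (a s') \in S.
  by apply: subgroupB; rewrite subgroup_signed.
have eB x y : e *+ nat_of_bool x - e *+ nat_of_bool y \in S by apply: subgroupB.
have sGS x : x \in S -> x \in G0 by apply: subsetP.
have eqsg : sg4 s = sg4 s'.
  have: c s - c s' \in G0.
    (* If a sum vanishes and all its terms but one lie in a subgroup, so does the remaining one. *)
    move: (subgroup0 _ G0); rewrite -key.
    rewrite (subgroupDr _ _ _ _ (sGS _ (eB _ _))) subgroupDl //.
    rewrite subgroupDl ?(sGS _ (aB _ _)) //.
    by apply: subgroupB; rewrite subgroup_signed.
  rewrite /c; case: (sg4 s); case: (sg4 s'); rewrite ?sub0r ?subr0 ?subgroupN //.
  - by rewrite (negbTE rG0).
  - by rewrite (negbTE rG0).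
have eqd : (d = d' %[mod n])%Z.
  have: b d - b d' \in S.
    move: (subgroup0 _ S); rewrite -key /c eqsg subrr addr0 subgroupDr //.
    by rewrite subgroupDl // signedB subgroup_signed.
  move/w_inj => /(_ (absz_modz_lt _ _ n0) (absz_modz_lt _ _ n0)).
  move=> eqdd; apply: (eqz_mod_divn n 1) => //; first by rewrite !modz1.
  by rewrite eqdd.
have eqsgd : sg4 d = sg4 d'.
  by rewrite /sg4 -(modz_modz_dvd _ _ d n4) eqd modz_modz_dvd.
have eqb : b d = b d' by rewrite /b eqd.
have eqs : (s = s' %[mod n])%Z.
  have: a s - a s' \in <[e]>%G.
    move: (subgroup0 _ <[e]>%G); rewrite -key /c eqsg eqsgd eqb !subrr !addr0.
    by rewrite subgroupDr ?signedB ?subgroup_signed //; apply: subgroupB;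
      apply: subgroup_mulrb.
  have lt4 x : (`|(x %% n)%Z| %/ 4 < k)%N by rewrite ltn_divLR // mulnC absz_modz_lt.
  move/t_inj => /(_ (lt4 _) (lt4 _)); apply: eqz_mod_divn => //.
  (* The parity of s is that of d, which is known because n is even. *)
  apply: sg4_mod4 eqsg _; apply: eqz_add_mod2.
  have n2 : (2 %| n)%N by apply: dvdn_trans n4.
  by rewrite -(modz_modz_dvd _ _ _ n2) eqd modz_modz_dvd.
apply: (ordinal_twisted_coordinates n F) => //.
apply: (mulrb_inj _ _ _ _ e0).
(* Only the difference of the [e] terms is left in [key]. *)
by rewrite -[RHS]key /c /a eqsg eqsgd eqb eqs !subrr !add0r.
Qed.

(** * The case n = 2m with m odd *)

Lemma torus_labeling_singly_even (m : nat) (Gamma : finZmodType) :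
  odd m -> (3 <= 2 * m)%N -> #|Gamma| = ((2 * m) ^ 2)%N ->
  exists l : 'I_(2 * m) * 'I_(2 * m) -> Gamma,
    distance_magic_labeling
      (cartesian_product (cycle_graph (2 * m)) (cycle_graph (2 * m))) l.
Proof.
move=> m_odd n3 cardG; set n := (2 * m)%N in n3 cardG *.
have abG (A : {set Gamma}) : abelian A by apply: FinRing.zmod_abelian.
have normG (A B : {group Gamma}) : A \subset B -> (A <| B)%g.
  by move=> sAB; rewrite /normal sAB (sub_abelian_norm (abG B)).
have [|e e0 oE] := involution_exists Gamma.
  by rewrite cardG; apply/dvdnP; exists (2 * m ^ 2)%N; lia.
have [||P [sEP _ oP]] := abelian_intermediate_subgroup _ <[e]>%G [set: Gamma]%G
  4 (abG _) (subsetT _).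
- by rewrite oE.
- by rewrite cardsT cardG; apply/dvdnP; exists (m ^ 2)%N; lia.
(* [P] may be cyclic or a Klein group; 4g = 0 in either case. *)
have [g gP gE] : exists2 g, g \in P & g \notin <[e]>%G.
  by apply/subsetPn/negP => /subset_leq_card; rewrite oP oE.
have [||O [_ _ oO]] := abelian_intermediate_subgroup _ 1%G [set: Gamma]%G
  (m ^ 2)%N (abG _) (subsetT _).
- by rewrite cards1.
- by rewrite cardsT cardG; apply/dvdnP; exists 4%N; lia.
have [||S [_ sSO oS]] := abelian_intermediate_subgroup _ 1%G O
  m (abG _) (sub1G _).
- by rewrite cards1.
- by rewrite oO; apply/dvdnP; exists m; lia.
have [|t [tS t_inj]] := coset_representatives _ _ _ m (normG _ _ (sub1G S)).
  by rewrite cards1 oS mul1n.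
have [|w [wO w_inj]] := coset_representatives _ _ _ m (normG _ _ sSO).
  by rewrite oS oO.
have eE : e \in <[e]>%G by apply: cycle_id.
have e2 : e *+ 2 = 0 by rewrite -oE; apply: expg_order.
have g4 : g *+ 4 = 0 by rewrite -oP; apply: expg_cardG.
have n0 : (0 < n)%N by apply: leq_trans n3.
have n2 : (2 %| n)%N by apply: dvdn_mulr.
have [q m_q] : exists q, m = q.*2.+1 by exists m./2; rewrite -[LHS]odd_double_half m_odd.
pose ind (s : int) := (`|(s %% n)%Z| %/ 2)%N.
have ind_lt s : (ind s < m)%N by rewrite ltn_divLR // mulnC absz_modz_lt.
(* With its own sign built in, [a] contributes sg(s) sg(d) t(ind s), and likewise [b]; this product
   of signs survives a shift of s and d by n, which flips both factors. *)
pose a (s : int) : Gamma := signed (sg4 s) (t (ind s)).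
pose b (d : int) : Gamma := signed (sg4 d) (w (ind d)).
pose c (s : int) : Gamma := g *+ (s %% 2 == 1)%Z.
(* As m is odd, n is 2 mod 4. *)
have sgn s : sg4 (s + n%:Z) = ~~ sg4 s by move: m_q; rewrite /sg4 /n; clear; lia.
have sgN s : sg4 (s - n%:Z) = ~~ sg4 s by rewrite -[s in RHS](subrK n%:Z) sgn negbK.
have modN s : ((s - n%:Z) %% n)%Z = (s %% n)%Z by rewrite -(modzDr (s - _)) subrK.
have cn s : c (s + n%:Z) = c s.
  by congr (g *+ nat_of_bool (_ == _)); move: m_q; rewrite /n; clear; lia.
have signedNN x y (v : Gamma) :
    signed (~~ x) (signed (~~ y) v) = signed x (signed y v).
  by case: x; case: y; rewrite /signed /= ?opprK.
exists (fun v : 'I_n * 'I_n =>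
  twisted_label a b c sg4 e (v.1%:Z + v.2%:Z) (v.1%:Z - v.2%:Z)).
apply: (diagonal_labeling _ _ _ 0) => //.
- move=> s d; rewrite /twisted_label cn /a /b /ind !sgn !modzDr !signedNN.
  by rewrite addNb addbN negbK.
- move=> s d; rewrite /twisted_label cn /a /b /ind !sgn !sgN !modzDr !modN !signedNN.
  by rewrite addNb addbN negbK.
- move=> s d; apply: twisted_label_sum => // u; rewrite /c.
  (* u - 1 and u + 1 have the same parity, so [g] occurs 0 or 4 times in the neighbor sum. *)
  have -> : ((u - 1) %% 2 == 1)%Z = ((u + 1) %% 2 == 1)%Z by clear; lia.
  by rewrite -mulr2n -[LHS]mulrnA mulrnAC (g4 : g *+ (2 * 2) = 0) mul0rn.
move=> [i j] [i' j'] /=.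
set s := i%:Z + j%:Z; set d := i%:Z - j%:Z.
set s' := i'%:Z + j'%:Z; set d' := i'%:Z - j'%:Z.
move=> /addr4_eq0; set ua := (X in X + _ + _ + _); set ub := (X in _ + X + _ + _).
set uc := (X in _ + X + _); set ue := (X in _ + X) => key.
have sSO' x : x \in S -> x \in O by apply: subsetP.
have sEP' x : x \in <[e]>%G -> x \in P by apply: subsetP.
have uaS : ua \in S by apply: subgroupB; rewrite !subgroup_signed.
have ubO : ub \in O by apply: subgroupB; rewrite !subgroup_signed.
have ueE : ue \in <[e]>%G by apply: subgroupB; apply: subgroup_mulrb.
have ucP : uc \in P by apply: subgroupB; apply: subgroup_mulrb.
have uce0 : uc + ue = 0.
  (* Since ua + ub lies in [O], so does its opposite uc + ue; the orders 4 and m^2 of [P] and [O]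
     are coprime. *)
  have : uc + ue \in P :&: O.
    rewrite inE (subgroupDl _ _ _ _ ucP) sEP' //=.
    have uabO : ua + ub \in O by rewrite (subgroupDl _ O _ _ (sSO' _ uaS)).
    by rewrite -(subgroupDl _ _ _ _ uabO) (addrA (ua + ub)) key subgroup0.
  rewrite coprime_TIg => [/set1P //|].
  rewrite oP oO; apply: coprimeXr; apply: (@coprimeXl 2 2).
  by rewrite coprime2n.
have eqs2 : (s = s' %[mod 2])%Z.
  (* A parity mismatch would make uc equal to g or -g, hence put g in <e>. *)
  have : uc \in <[e]>%G.
    by rewrite -(subgroupDr _ _ ue) // uce0 subgroup0.
  rewrite /uc /c; move: gE.
  have := ltz_pmod s (d := 2) isT; have := ltz_pmod s' (d := 2) isT.
  have := modz_ge0 s (d := 2) isT; have := modz_ge0 s' (d := 2) isT.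
  case: (s %% 2)%Z => [[|[|u]]|u] //; case: (s' %% 2)%Z => [[|[|v]]|v] //= _ _ _ _;
    by rewrite mulr0n mulr1n ?sub0r ?subr0 ?subgroupN => /negPf ->.
have uc0 : uc = 0 by rewrite /uc /c eqs2 subrr.
have ue0 : ue = 0 by rewrite -uce0 uc0 add0r.
have eqF : sg4 s (+) sg4 d = sg4 s' (+) sg4 d' by apply: mulrb_inj ue0.
have eqd2 : (d = d' %[mod 2])%Z.
  by apply: (eqz_add_mod2 i%:Z (- j%:Z) i'%:Z (- j'%:Z)); rewrite !opprK.
have signed_addb x y (v : Gamma) : signed x (signed y v) = signed (~~ (x (+) y)) v.
  by case: x; case: y; rewrite /signed /= ?opprK.
(* By [eqF] the product sg(s) sg(d) is the same sign for both vertices, so it factors out of both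
   differences. *)
have [x [uaE ubE]] : exists x, ua = signed x (t (ind s) - t (ind s')) /\
    ub = signed x (w (ind d) - w (ind d')).
  exists (~~ (sg4 s (+) sg4 d)).
  by rewrite /ua /ub /a /b !signed_addb ![sg4 _ (+) sg4 s']addbC -eqF signedB
             [sg4 d (+) _]addbC signedB.
have eqd : (d = d' %[mod n])%Z.
  have : w (ind d) - w (ind d') \in S.
    rewrite -(subgroup_signed _ S x) -ubE -(subgroupDl _ _ ua) //.
    by rewrite -[ua + ub]addr0 -uce0 (addrA (ua + ub)) key subgroup0.
  by move/w_inj => /(_ (ind_lt _) (ind_lt _)); apply: eqz_mod_divn eqd2.
have eqs : (s = s' %[mod n])%Z.
  have ub0 : ub = 0 by rewrite ubE /ind eqd subrr /signed oppr0 if_same.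
  have : t (ind s) - t (ind s') \in 1%G.
    rewrite -(subgroup_signed _ 1%G x) -uaE.
    by rewrite -[ua]addr0 -ub0 -[ua + ub]addr0 -uce0 (addrA (ua + ub)) key subgroup0.
  by move/t_inj => /(_ (ind_lt _) (ind_lt _)); apply: eqz_mod_divn eqs2.
by apply: (ordinal_twisted_coordinates n sg4).
Qed.

(* Assembly according to the parity of n / 2 *)
Local Close Scope ring_scope.

Theorem theorem2p4 (n : nat) (n_ge3 : 3 <= n) (n_even : ~~ odd n)
    (Gamma : finZmodType) (card_Gamma : #|Gamma| = n ^ 2) :
  exists l : 'I_n * 'I_n -> Gamma,
    distance_magic_labeling
      (cartesian_product (cycle_graph n) (cycle_graph n)) l.
Proof.
have [m n_m] : exists m, n = 2 * m.
  by exists n./2; rewrite mul2n even_halfK.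
rewrite {}n_m in n_ge3 card_Gamma n_even *.
have [m_odd | m_even] := boolP (odd m).
  exact: torus_labeling_singly_even.
have [k m_k] : exists k, m = 2 * k by exists m./2; rewrite mul2n even_halfK.
rewrite {}m_k mulnA in n_ge3 card_Gamma *.
by apply: torus_labeling_doubly_even => //; case: (k) n_ge3.
Qed.
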